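(* Let $i\in\{1,2\}$ and $j\in\{1,2,4\}$, and let $\mathcal A$ be an $(\mathbf i,\mathbf j)$-automaton. Then $\mathcal A$ is either not $3$-compressible or not proper (that is, if $\mathcal A$ is $3$-compressible, then some word of length $3$ $3$-compresses it).
   Context: A (semi)automaton is $\mathcal A=(Q,\Sigma,\delta)$ with $Q$ a finite set of states, $\Sigma=\{a,b\}$, and $\delta:Q\times\Sigma\to Q$ total. Words act on states from the right, letter by letter from left to right: $qw$ is the state reached from $q$ by reading $w$, and $Qw=\{qw:q\in Q\}$. A word $w$ $3$-compresses $\mathcal A$ if $|Q|-|Qw|\ge 3$; $\mathcal A$ is $3$-compressible if some word $3$-compresses it. A $3$-compressible automaton is proper if no word of length $3$ $3$-compresses it. For a letter $c\in\{a,b\}$ (distinct letters $x,y,z,v$ denoting distinct states): - $c$ is of type $\mathbf 1$ if it is of the form $[x,y,z]\backslash x,y$: $xc=yc=zc$, no other two distinct states have the same image under $c$, and $Q\setminus Qc=\{x,y\}$; - $c$ is of type $\mathbf 2$ if it is of the form $[x,y][z,v]\backslash x,z$: $xc=yc$, $zc=vc$, $xc\ne zc$, no other two distinct states have the same image under $c$, and $Q\setminus Qc=\{x,z\}$; - $c$ is of type $\mathbf 4$ if it is of the form $[x,y]\backslash z$ with $zc=x$: $xc=yc$, no other two distinct states have the same image under $c$, $Q\setminus Qc=\{z\}$, and $zc=x$. An $(\mathbf i,\mathbf j)$-automaton is an automaton on $\{a,b\}$ in which $a$ is of type $\mathbf i$ and $b$ is of type $\mathbf j$. *)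

(* Defs.v *)
From mathcomp Require Import all_boot.

Set Implicit Arguments.
Unset Strict Implicit.
Unset Printing Implicit Defensive.

Inductive letter : Type := la | lb.

Record automaton : Type := Automaton {
  state : finType;
  delta : state -> letter -> state
}.

(* Words act on the right: the head of the sequence is read first. *)
Definition act (A : automaton) (q : state A) (w : seq letter) : state A :=
  foldl (@delta A) q w.

Definition act_image (A : automaton) (w : seq letter) : {set state A} :=
  [set act q w | q : state A].

Definition letter_image (A : automaton) (c : letter) : {set state A} :=
  [set delta q c | q : state A].

Definition compresses3 (A : automaton) (w : seq letter) : Prop :=
  3 <= #|state A| - #|act_image A w|.

Definition compressible3 (A : automaton) : Prop :=
  exists w : seq letter, compresses3 A w.

Definition proper3 (A : automaton) : Prop :=
  compressible3 A /\
  ~ (exists w : seq letter, size w = 3 /\ compresses3 A w).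

(* [x, y, z] \ x, y *)
Definition type1 (A : automaton) (c : letter) : Prop :=
  exists x y z : state A,
    [/\ uniq [:: x; y; z],
        delta x c = delta y c,
        delta y c = delta z c,
        forall p q : state A, p != q -> delta p c = delta q c ->
          [set p; q] \subset [set x; y; z]
      & ~: letter_image A c = [set x; y]].

(* [x, y] [z, v] \ x, z *)
Definition type2 (A : automaton) (c : letter) : Prop :=
  exists x y z v : state A,
    uniq [:: x; y; z; v] /\
    [/\ delta x c = delta y c,
        delta z c = delta v c,
        delta x c <> delta z c,
        forall p q : state A, p != q -> delta p c = delta q c ->
          [set p; q] = [set x; y] \/ [set p; q] = [set z; v]
      & ~: letter_image A c = [set x; z]].

(* [x, y] \ z with z c = x *)
Definition type4 (A : automaton) (c : letter) : Prop :=
  exists x y z : state A,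
    [/\ uniq [:: x; y; z],
        delta x c = delta y c,
        forall p q : state A, p != q -> delta p c = delta q c ->
          [set p; q] = [set x; y],
        ~: letter_image A c = [set z]
      & delta z c = x].

(* Only the indices 1, 2 and 4 denote letter types. *)
Definition has_type (A : automaton) (i : nat) (c : letter) : Prop :=
  match i with
  | 1 => type1 A c
  | 2 => type2 A c
  | 4 => type4 A c
  | _ => False
  end.

Definition ij_automaton (i j : nat) (A : automaton) : Prop :=
  has_type A i la /\ has_type A j lb.

(* Main.v *)
Require Import Defs.
From mathcomp Require Import all_boot.
From mathcomp Require Import zify.
From Stdlib Require Import Classical.

(** Let [n] be the number of states and suppose that no word of length 3
    compresses the automaton by 3, so that all words of length 3 have an image
    of size at least [n - 2].  On the other hand all words of length 2 have an
    image of size at most [n - 2]: the letter [a] already misses two states,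
    and a word of length 2 without [a] is [bb], which misses two states as
    well (for type 4, where [b] misses only [z], the second missed state is
    [z b]: see [type4_double_image]).

    These two bounds settle the matter ([stable_card]).  Reading one more
    letter in front of a word can only shrink its image, and for a word [v] of
    length 2 there is no room for a strict shrinking: [Qcv] is contained in
    [Qv] and is not smaller.  So [Qcv = Qv], hence [Qcvs = Qvs] for every
    word [s]: the first letter of a word of length at least 3 may be deleted
    without changing the image.  Deleting first letters until three are left,
    every long word has an image of size at least [n - 2]. *)

Section Images.

Variable A : automaton.
Implicit Types (u v w s : seq letter) (c : letter).

Lemma act_image_cat u v :
  act_image A (u ++ v) = [set act q v | q in act_image A u].
Proof.
rewrite /act_image -imset_comp; apply: eq_imset => q.
by rewrite /act foldl_cat.
Qed.

Lemma act_image_cat_sub u v : act_image A (u ++ v) \subset act_image A v.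
Proof. by rewrite act_image_cat; apply: imsetS; apply/subsetP. Qed.

Lemma card_act_image_catl u v : #|act_image A (u ++ v)| <= #|act_image A u|.
Proof. by rewrite act_image_cat leq_imset_card. Qed.

Lemma card_act_image_catr u v : #|act_image A (u ++ v)| <= #|act_image A v|.
Proof. exact: subset_leq_card (act_image_cat_sub u v). Qed.

(** The length-[k] prefix of [w] has the same image with or without [c] in
    front: the images are nested, and the bounds force equal cardinals. *)
Lemma act_image_cons (k m : nat) :
    (forall v, size v = k -> #|act_image A v| <= m) ->
    (forall v, size v = k.+1 -> m <= #|act_image A v|) ->
  forall c w, k <= size w -> act_image A (c :: w) = act_image A w.
Proof.
move=> le_m ge_m c w le_kw.
have size_pre : size (take k w) = k by apply: size_takel.
have eq_pre : act_image A (c :: take k w) = act_image A (take k w).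
  apply/eqP; rewrite eqEcard (act_image_cat_sub [:: c]) /=.
  by apply: leq_trans (le_m _ size_pre) (ge_m _ _); rewrite /= size_pre.
by rewrite -(cat_take_drop k w) -cat_cons !act_image_cat eq_pre.
Qed.

Lemma stable_card (k m : nat) :
    (forall v, size v = k -> #|act_image A v| <= m) ->
    (forall v, size v = k.+1 -> m <= #|act_image A v|) ->
  forall w, m <= #|act_image A w|.
Proof.
move=> le_m ge_m.
have long w : k < size w -> m <= #|act_image A w|.
  elim: w => [//|c w IHw] /=; rewrite ltnS leq_eqVlt => /orP[/eqP eq_kw|lt_kw].
    by apply: ge_m; rewrite /= eq_kw.
  by rewrite (act_image_cons _ _ le_m ge_m) ?IHw // ltnW.
(* A short word is first padded on the left, which only shrinks its image. *)
move=> w; apply: leq_trans (card_act_image_catr (nseq k.+1 la) w).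
by apply: long; rewrite size_cat size_nseq leq_addr.
Qed.

Lemma card_act_image_missing2 w (x y : state A) :
    x != y -> x \notin act_image A w -> y \notin act_image A w ->
  #|act_image A w| <= #|state A| - 2.
Proof.
move=> neq_xy x_miss y_miss.
have : #|[set x; y]| <= #|~: act_image A w|.
  apply: subset_leq_card; apply/subsetP => p.
  by rewrite !inE => /orP[] /eqP ->.
by rewrite cards2 neq_xy cardsCs setCK; lia.
Qed.

Lemma letter_missing2 c (x y : state A) :
    x != y -> ~: letter_image A c = [set x; y] ->
  #|act_image A [:: c]| <= #|state A| - 2.
Proof.
move=> neq_xy missE; apply: (card_act_image_missing2 _ x y) => //.
  by have := set21 x y; rewrite -missE inE.
by have := set22 x y; rewrite -missE inE.
Qed.

Lemma type1_image c : type1 A c -> #|act_image A [:: c]| <= #|state A| - 2.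
Proof.
case=> x [y [z [uniq_xyz _ _ _ missE]]]; apply: letter_missing2 missE.
by move: uniq_xyz; rewrite /= !inE; case: (x == y).
Qed.

Lemma type2_image c : type2 A c -> #|act_image A [:: c]| <= #|state A| - 2.
Proof.
case=> x [y [z [v [uniq_xyzv [_ _ _ _ missE]]]]]; apply: letter_missing2 missE.
by move: uniq_xyzv; rewrite /= !inE; case: (x == z); rewrite ?orbT.
Qed.

(** Since [z] lies in no collapsed pair, it is the only preimage of
    [x = z c]; as [z] is not in the image of [c], the state [x] is lost when
    [c] is read a second time. *)
Lemma type4_double_image c :
  type4 A c -> #|act_image A [:: c; c]| <= #|state A| - 2.
Proof.
case=> x [y [z [uniq_xyz _ collapse missE zc]]].
have [neq_xz neq_yz] : x != z /\ y != z.
  by move: uniq_xyz; rewrite /= !inE; case: (x == z); case: (y == z); case: (x == y).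
have z_miss q : delta q c != z.
  apply/eqP => qc; have : z \in ~: letter_image A c by rewrite missE set11.
  by rewrite inE -qc imset_f.
apply: (card_act_image_missing2 _ x z) => //; apply/imsetP => -[q _] /=.
  move=> xE; have := collapse _ z (z_miss q); rewrite zc -xE => /(_ erefl).
  move/setP/(_ z); rewrite !inE eqxx orbT.
  by rewrite ![z == _]eq_sym (negbTE neq_xz) (negbTE neq_yz).
by move=> zE; have := z_miss (delta q c); rewrite -zE eqxx.
Qed.

Lemma type12_image (i : nat) c :
    i \in [:: 1; 2] -> has_type A i c ->
  #|act_image A [:: c]| <= #|state A| - 2.
Proof.
by rewrite !inE => /orP[] /eqP ->; [apply: type1_image | apply: type2_image].
Qed.

Lemma type124_double_image (j : nat) c :
    j \in [:: 1; 2; 4] -> has_type A j c ->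
  #|act_image A [:: c; c]| <= #|state A| - 2.
Proof.
rewrite !inE orbA => /orP[j12 type_c | /eqP ->]; last exact: type4_double_image.
apply: leq_trans (card_act_image_catl [:: c] [:: c]) _.
by apply: type12_image type_c; rewrite !inE.
Qed.

End Images.

Theorem proposition12 (i j : nat) (A : automaton) :
  i \in [:: 1; 2] -> j \in [:: 1; 2; 4] -> ij_automaton i j A ->
  ~ compressible3 A \/ ~ proper3 A.
Proof.
move=> i12 j124 [type_a type_b].
have [short | no_short] :=
  classic (exists w : seq letter, size w = 3 /\ compresses3 A w).
  by right=> -[_].
left=> -[w]; rewrite /compresses3.
have image_a := type12_image _ _ _ i12 type_a.
have le2 v : size v = 2 -> #|act_image A v| <= #|state A| - 2.
  case: v => [|c [|d [|]]] // _; case: c => [|].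
    exact: leq_trans (card_act_image_catl _ [:: la] [:: d]) image_a.
  case: d => [|]; last exact: type124_double_image j124 type_b.
  exact: leq_trans (card_act_image_catr _ [:: lb] [:: la]) image_a.
have ge3 v : size v = 3 -> #|state A| - 2 <= #|act_image A v|.
  move=> size_v; case: (leqP 3 (#|state A| - #|act_image A v|)) => [cmp_v|].
    by case: no_short; exists v.
  by lia.
by have := stable_card _ _ _ le2 ge3 w; lia.
Qed.
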